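(* If $M = M_1 \times \cdots \times M_m$ is a product of nonlinear differentiable hypersurfaces $M_i\subseteq\mathbb{R}^{n_i+1}$ ($i=1,\dots,m$), then $\operatorname{int}(\Delta_* TM) \neq \varnothing$, where the interior is taken in the ambient space $\mathbb{R}^{n_1+1}\times\cdots\times\mathbb{R}^{n_m+1}$.
   Context: A topological $d$-submanifold of $\mathbb{R}^n$ is a topological subspace $M\subseteq\mathbb{R}^n$ that is a topological $d$-manifold in the induced topology; all manifolds are assumed connected. $M$ is called a differentiable submanifold iff for every $p\in M$, in a neighbourhood of $p$ the set $M$ coincides (up to a rigid motion) with the graph of a (once, everywhere) differentiable map $f$ from an open subset of $\mathbb{R}^d$ to $\mathbb{R}^{n-d}$; the derivative need not be continuous. A hypersurface is a submanifold of codimension $1$. A submanifold $M$ of $\mathbb{R}^n$ is linear iff there is an affine subspace $\Pi\subseteq\mathbb{R}^n$ such that $M$ is an open subset of $\Pi$; otherwise it is nonlinear. The tangent space $T_pM$ is the image of the differential of the local parametrization $x\mapsto(x,f(x))$, and $TM=\{(p,u): p\in M,\ u\in T_pM\}$. The codiagonal map is $\Delta_*(x,y)=x+y$, so $\Delta_*TM=\bigcup_{p\in M}(p+T_pM)$. *)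

(* Defs.v *)
From HB Require Import structures.
From mathcomp Require Import all_boot all_order all_algebra.
From mathcomp Require Import all_classical all_reals all_analysis.
Set Implicit Arguments.
Unset Strict Implicit.
Unset Printing Implicit Defensive.
Import Order.TTheory GRing.Theory Num.Theory.
Import numFieldNormedType.Exports.
Local Open Scope classical_set_scope.
Local Open Scope ring_scope.

(* The Hausdorff and second-countability axioms are inherited from R^N, so only
   connectedness and local Euclideanness appear: near each point, M is
   homeomorphic, via h and its inverse g, to an open subset V of R^d. *)
Definition topological_submanifold (R : realType) (N d : nat)
    (M : set 'rV[R]_N) : Prop :=
  connected M /\
  forall p, M p ->
    exists (U : set 'rV[R]_N) (V : set 'rV[R]_d)
           (h : 'rV[R]_d -> 'rV[R]_N) (g : 'rV[R]_N -> 'rV[R]_d),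
      [/\ open U /\ U p, open V,
          M `&` U = h @` V,
          {in V, cancel h g} &
          {within V, continuous h} /\ {within M `&` U, continuous g}].

(* The two equations force d + k = N, so x |-> c + x *m Q is a Euclidean
   isometry from R^(d + k) onto R^N. Improper isometries are allowed; on graphs
   they give nothing new: flip the sign of a coordinate of x or of f x. *)
Definition orthogonal_mx (R : realType) (d k N : nat)
    (Q : 'M[R]_(d + k, N)) : Prop :=
  Q *m Q^T = 1%:M /\ Q^T *m Q = 1%:M.

Definition graph_param (R : realType) (d k N : nat) (c : 'rV[R]_N)
    (Q : 'M[R]_(d + k, N)) (f : 'rV[R]_d -> 'rV[R]_k) (x : 'rV[R]_d) :
    'rV[R]_N :=
  c + row_mx x (f x) *m Q.

(* Within the open set U, the set M is, up to a rigid motion, the graph of f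
   over the open set V; the values of f outside V are irrelevant. *)
Definition graph_chart (R : realType) (d k N : nat) (M U : set 'rV[R]_N)
    (c : 'rV[R]_N) (Q : 'M[R]_(d + k, N))
    (V : set 'rV[R]_d) (f : 'rV[R]_d -> 'rV[R]_k) : Prop :=
  [/\ open U, open V, orthogonal_mx Q,
      (forall x, V x -> differentiable f x) &
      M `&` U = graph_param c Q f @` V].

(* d is the dimension and k the codimension. *)
Definition differentiable_submanifold (R : realType) (d k N : nat)
    (M : set 'rV[R]_N) : Prop :=
  topological_submanifold d M /\
  forall p, M p ->
    exists (U : set 'rV[R]_N) (c : 'rV[R]_N) (Q : 'M[R]_(d + k, N))
           (V : set 'rV[R]_d) (f : 'rV[R]_d -> 'rV[R]_k),
      U p /\ graph_chart M U c Q V f.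

Definition differentiable_hypersurface (R : realType) (n : nat)
    (M : set 'rV[R]_n.+1) : Prop :=
  differentiable_submanifold n 1 M.

Definition linear_submanifold (R : realType) (N : nat)
    (M : set 'rV[R]_N) : Prop :=
  exists (c : 'rV[R]_N) (W : {vspace 'rV[R]_N}) (O : set 'rV[R]_N),
    open O /\ M = O `&` [set x | x - c \in W].

(* Independent of the chart: pointwise differentiability of f already makes the
   image of the differential the tangent cone of M at p. *)
Definition tangent_space (R : realType) (d k N : nat) (M : set 'rV[R]_N)
    (p : 'rV[R]_N) : set 'rV[R]_N :=
  [set u | exists (U : set 'rV[R]_N) (c : 'rV[R]_N) (Q : 'M[R]_(d + k, N))
                  (V : set 'rV[R]_d) (f : 'rV[R]_d -> 'rV[R]_k)
                  (x v : 'rV[R]_d),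
      [/\ graph_chart M U c Q V f, V x, p = graph_param c Q f x &
          u = 'd (graph_param c Q f) x v]].

Definition tangent_bundle (R : realType) (d k N : nat) (M : set 'rV[R]_N) :
    set ('rV[R]_N * 'rV[R]_N) :=
  [set pu | M pu.1 /\ tangent_space d k M pu.1 pu.2].

Definition codiagonal (R : realType) (N : nat)
    (pu : 'rV[R]_N * 'rV[R]_N) : 'rV[R]_N :=
  pu.1 + pu.2.

(* R^(q 0) x ... x R^(q (m - 1)) is R^(\sum_i q i) by concatenation;
   submxrow x i is the i-th block of x. *)
Definition product_set (R : realType) (m : nat) (q : 'I_m -> nat)
    (M : forall i : 'I_m, set 'rV[R]_(q i)) :
    set 'rV[R]_(\sum_(i < m) q i) :=
  [set x | forall i : 'I_m, M i (submxrow x i)].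

(* Main.v *)
Require Import Defs.
From HB Require Import structures.
From mathcomp Require Import all_boot all_order all_algebra.
From mathcomp Require Import all_classical all_reals all_analysis.
From mathcomp Require Import lra.
Import Order.TTheory GRing.Theory Num.Theory.
Import numFieldNormedType.Exports.
Local Open Scope classical_set_scope.
Local Open Scope ring_scope.
Set Implicit Arguments.
Unset Strict Implicit.
Unset Printing Implicit Defensive.

(** Write a hypersurface locally as the graph of a differentiable function [f]
on a ball. Its affine tangent hyperplane over [p] is the graph of
[x |-> f p + 'd f p (x - p)], called [tangent_value f p]. So the union of these
hyperplanes contains the point [(x, c)] as soon as [c] is one of the values at
the fixed point [x] of the function [p |-> tangent_value f p x].

This function of [p] need not be continuous, because ['d f] need not be, but it
has the Darboux property ([tangent_value_darboux]). The reason is that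
[tangent_value f p x] is itself a derivative: it is the derivative at [s = 1]
of the perspective rescaling [s |-> s * f (x + (p - x) / s)] centred at [x]. As
for the classical Darboux theorem, a value [c] between two values of the
derivative is attained by a difference quotient, which is continuous in [p],
and the mean value theorem turns the quotient back into a derivative at a
nearby point.

Hence there is an alternative on each ball ([affine_or_tangents_cover]). If two
tangent hyperplanes differ, they have different heights [c' < c''] above some
[x]; this persists for nearby [x] since a tangent hyperplane is continuous, so
by the Darboux property all points near [(x, (c' + c'') / 2)] are covered. If
all tangent hyperplanes coincide, [f] is affine on the ball.

If the second case holds around every point of [M], then [M] is locally an open
piece of an affine subspace. The germ of [M] at a point determines this
subspace, so its direction and position are locally constant along [M], hence
constant because [M] is connected, and [M] is linear
([connected_flat_linear]). A nonlinear hypersurface therefore has a chart whose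
affine tangent hyperplanes alone cover a nonempty open set
([nonlinear_hypersurface_tangents]).

Finally, such charts of the factors are assembled into one chart of the product
([product_graph_chart]), whose affine tangent spaces are the products of those
of the factors ([submxrow_product_tangent]); so the product of the open sets
found for the factors is covered. *)

(** * The Darboux property of tangent values *)

Section TangentValue.
Context {R : realType} {E : normedModType R}.
Implicit Types (f : E -> R) (a b p x : E) (B : set E).

Definition tangent_value f p x : R := f p + 'd f p (x - p).

(** With [phi u = f (x + u *: (p - x))] this is [s |-> s * phi (1 / s)], whose
derivative [phi (1 / s) - phi' (1 / s) / s] is the height at [0] of the tangent
line to [phi] at [1 / s]. *)
Definition rescaled f x p (s : R) : R := s * f (x + s^-1 *: (p - x)).

Lemma is_derive_rescaled f x p (s : R) :
  s != 0 -> differentiable f (x + s^-1 *: (p - x)) ->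
  is_derive s 1 (rescaled f x p) (tangent_value f (x + s^-1 *: (p - x)) x).
Proof.
move=> s0; set y := x + _ => dfy.
pose g (t : R) := x + t^-1 *: (p - x).
have dinv : is_diff s (GRing.inv : R -> R) (fun h => - s ^- 2 *: h).
  by apply: DiffDef; [exact: differentiable_Rinv | rewrite diff_Rinv].
have dg : is_diff s g (0 + (( *:%R^~ (p - x)) \o (fun h : R => - s ^- 2 *: h))).
  have -> : g = cst x + (( *:%R^~ (p - x)) \o (GRing.inv : R -> R)) by [].
  by apply: is_diffD.
have dfg : is_diff s (f \o g) ('d f y \o 'd g s).
  have [dg' _] := dg.
  exact: is_diff_comp (differentiableP dg') (differentiableP dfy).
have dr : is_diff s (rescaled f x p) (s *: ('d f y \o 'd g s) + f y *: idfun).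
  exact: (is_diffM (is_diff_id s) dfg).
have dd : derivable (rescaled f x p) s 1 by apply/derivable1_diffP.
apply: DeriveDef => //.
rewrite deriveE // !diff_val /tangent_value.
transitivity (s *: 'd f y (0 + ((- s ^- 2 *: (1 : R)) *: (p - x) : E)) +
  f y *: (1 : R)); first by [].
rewrite add0r [f y *: 1]mulr1 addrC; congr (_ + _).
rewrite -linearZ [- s ^- 2 *: 1]mulr1; congr ('d f _ _).
rewrite scalerA expr2 invfM mulrN mulrA mulfV // mul1r scaleNr.
by rewrite /y opprD addNKr.
Qed.


Lemma rescaled_near1 B x q : open B -> B q ->
  \forall h \near 0^'+,
    forall s : R, 1 <= s <= 1 + h -> B (x + s^-1 *: (q - x)).
Proof.
move=> oB Bq.
have cg : {for (1 : R), continuous (fun t : R => x + t^-1 *: (q - x))}.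
  apply: cvgD; first exact: cvg_cst.
  apply: cvgZr_tmp.
  by apply: cvgV; [rewrite oner_eq0 | exact: cvg_id].
have : \forall s \near (1 : R), B (x + s^-1 *: (q - x)).
  apply: cg; apply: open_nbhs_nbhs; split=> //.
  by rewrite invr1 scale1r subrKC.
move=> /nbhs_ballP[e /= e0 eB]; near=> h => s /andP[s1 sh].
apply: eB; rewrite /ball /= ler0_norm; last by rewrite subr_le0.
rewrite opprB ltrBlDl (le_lt_trans sh) // ltrD2l.
by near: h; exact: nbhs_right_lt.
Unshelve. all: by end_near. Qed.

Lemma rescaled_quotient_cvg f x q : differentiable f q ->
  h^-1 *: (rescaled f x q (h + 1) - rescaled f x q 1) @[h --> 0^'+]
    --> tangent_value f q x.
Proof.
move=> dfq.
have q1 : x + 1^-1 *: (q - x) = q by rewrite invr1 scale1r subrKC.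
have := @is_derive_rescaled f x q 1 (oner_neq0 _).
rewrite q1 => /(_ dfq)[dr dE].
rewrite -dE; apply: cvg_dnbhs_at_right.
have dr' : h^-1 *: (rescaled f x q (h *: (1 : R) + 1) - rescaled f x q 1)
   @[h --> 0^'] --> 'D_1 (rescaled f x q) 1 by exact: dr.
by under eq_fun do rewrite -[X in rescaled _ _ _ (X + 1)]mulr1.
Qed.

(** Darboux's argument: for a small step [h], the difference quotient [Q] of the
rescaling between the scales [1] and [1 + h] is a continuous function of the
point, so it takes the value [c] somewhere on the segment from [a] to [b]; by
the mean value theorem in the scale it is also a tangent value. Convexity keeps
the rescaled segment in [B], since rescaling maps segments to segments and the
rescaled endpoints stay in [B]. *)
Lemma tangent_value_darboux f B x a b (c : R) :
  open B ->
  (forall p q t, B p -> B q -> 0 <= t <= 1 -> B (p + t *: (q - p))) ->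
  (forall p, B p -> differentiable f p) -> B a -> B b ->
  tangent_value f a x < c -> c < tangent_value f b x ->
  exists2 p, B p & tangent_value f p x = c.
Proof.
move=> oB cB df Ba Bb ac cb.
near (0 : R)^'+ => h.
have h0 : 0 < h by near: h; exact: nbhs_right_gt.
have Bah : forall s, 1 <= s <= 1 + h -> B (x + s^-1 *: (a - x)).
  by near: h; exact: rescaled_near1.
have Bbh : forall s, 1 <= s <= 1 + h -> B (x + s^-1 *: (b - x)).
  by near: h; exact: rescaled_near1.
pose seg t := a + t *: (b - a).
have Bseg t s : 0 <= t <= 1 -> 1 <= s <= 1 + h -> B (x + s^-1 *: (seg t - x)).
  move=> t01 sh.
  have -> : x + s^-1 *: (seg t - x) = (x + s^-1 *: (a - x)) +
      t *: ((x + s^-1 *: (b - x)) - (x + s^-1 *: (a - x))).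
    have -> : x + s^-1 *: (b - x) - (x + s^-1 *: (a - x)) = s^-1 *: (b - a).
      by rewrite opprD addrACA subrr add0r -scalerBr opprB addrA subrK.
    by rewrite /seg addrAC scalerDr addrA !scalerA mulrC.
  by apply: cB => //; [exact: Bah|exact: Bbh].
pose Q t : R :=
  h^-1 *: (rescaled f x (seg t) (h + 1) - rescaled f x (seg t) 1).
have QE t : 0 <= t <= 1 -> exists2 p, B p & tangent_value f p x = Q t.
  move=> t01.
  have h1 : 1 < 1 + h by rewrite ltrDl.
  have dr s : s \in `[1, 1 + h] -> is_derive s 1 (rescaled f x (seg t))
      (tangent_value f (x + s^-1 *: (seg t - x)) x).
    rewrite in_itv/= => sh; apply: is_derive_rescaled; last exact/df/Bseg.
    by rewrite gt_eqF // (lt_le_trans ltr01); case/andP: sh.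
  have cr : {within `[1, 1 + h], continuous (rescaled f x (seg t))}.
    by apply: derivable_within_continuous => s sh; have [] := dr s sh.
  have dr' s : s \in `]1, 1 + h[ -> is_derive s 1 (rescaled f x (seg t))
      (tangent_value f (x + s^-1 *: (seg t - x)) x).
    by move=> sh; apply: dr; exact: subset_itv_oo_cc.
  have [s sh] := MVT h1 dr' cr.
  rewrite [1 + h - 1]addrAC subrr add0r => E1.
  exists (x + s^-1 *: (seg t - x)).
    by apply: Bseg => //; move/subset_itv_oo_cc: sh; rewrite in_itv.
  by rewrite /Q [h + 1]addrC E1 -[h^-1 *: _]/(h^-1 * _) mulrC mulfK // gt_eqF.
have cQ : {within `[0, 1], continuous Q}.
  apply: continuous_in_subspaceT => t; rewrite inE /= in_itv /= => t01.
  have cseg s : 1 <= s <= 1 + h ->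
      {for t, continuous (fun t => rescaled f x (seg t) s)}.
    move=> sh; rewrite /rescaled; apply: cvgM; first exact: cvg_cst.
    apply: (@continuous_comp _ _ _ (fun t => x + s^-1 *: (seg t - x)) f).
      apply: cvgD; first exact: cvg_cst.
      apply: cvgZl_tmp; apply: cvgB; last exact: cvg_cst.
      apply: cvgD; first exact: cvg_cst.
      exact: scalel_continuous.
    exact/differentiable_continuous/df/Bseg.
  apply: cvgZl_tmp; apply: cvgB; apply: cseg;
    rewrite ?lexx ?lerDl ?lerDr ?[h + 1]addrC ?lexx ?lerDl ?ltW //.
have [t t01 <-] : exists2 t, t \in `[0, 1] & Q t = c.
  apply: IVT => //; rewrite /Order.min /Order.max.
  have Q0 : Q 0 < c.
    rewrite /Q /seg scale0r addr0; near: h.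
    exact: (cvgr_lt _ (rescaled_quotient_cvg (x := x) (df _ Ba)) _ ac).
  have Q1 : c < Q 1.
    rewrite /Q /seg scale1r subrKC; near: h.
    exact: (cvgr_gt _ (rescaled_quotient_cvg (x := x) (df _ Bb)) _ cb).
  by rewrite (lt_trans Q0 Q1) !ltW.
by apply: QE; move: t01; rewrite in_itv.
Unshelve. all: by end_near. Qed.


Lemma segment_in_ball x0 (r : R) p q (t : R) :
  ball x0 r p -> ball x0 r q -> 0 <= t <= 1 -> ball x0 r (p + t *: (q - p)).
Proof.
rewrite -ball_normE /= => xp xq /andP[t0 t1].
have -> : x0 - (p + t *: (q - p)) = (1 - t) *: (x0 - p) + t *: (x0 - q).
  rewrite scalerBl scale1r -addrA -scalerN -scalerDr opprB addrA subrK.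
  by rewrite opprD addrA -scalerN opprB.
rewrite (le_lt_trans (ler_normD _ _)) // !normrZ (ger0_norm t0).
rewrite ger0_norm ?subr_ge0 //.
move: `|x0 - p| `|x0 - q| xp xq => A B Ar Br.
by have [AB|BA] := leP A B; [apply: le_lt_trans Br|apply: le_lt_trans Ar]; nra.
Qed.

Lemma tangent_value_continuous f p : differentiable f p ->
  continuous (tangent_value f p).
Proof.
move=> df x; apply: cvgD; first exact: cvg_cst.
apply: (@continuous_comp _ _ _ (fun x => x - p) ('d f p));
  last exact: diff_continuous.
by apply: cvgB; [exact: cvg_id|exact: cvg_cst].
Qed.

(** If [f] is not affine, then over some [x1] its graph leaves the tangent
hyperplane at [x0]. Since the graph meets the tangent hyperplane at [x1] there,
two tangent values at [x1] differ, and the strict inequality between them is an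
open condition on the point of evaluation. *)
Lemma affine_or_tangents_cover f x0 (r : R) :
  0 < r -> (forall p, ball x0 r p -> differentiable f p) ->
  (forall p, ball x0 r p -> f p = tangent_value f x0 p) \/
  exists xc : E * R, \forall z \near xc,
    exists2 p, ball x0 r p & tangent_value f p z.1 = z.2.
Proof.
move=> r0 df.
have [aff|] := pselect (forall p, ball x0 r p -> f p = tangent_value f x0 p).
  by left.
move=> /existsNP[x1] /not_implyP[Bx1 fx1]; right.
have Bx0 : ball x0 r x0 by exact: ballxx.
have [a [b [Ba Bb ab]]] : exists a b, [/\ ball x0 r a, ball x0 r b &
    tangent_value f a x1 < tangent_value f b x1].
  have fE : f x1 = tangent_value f x1 x1.
    by rewrite /tangent_value subrr linear0 addr0.
  move: fx1; rewrite fE => /eqP; rewrite neq_lt => /orP[lt|lt].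
    by exists x1, x0.
  by exists x0, x1.
pose c1 := (tangent_value f a x1 + tangent_value f b x1) / 2.
have ac : tangent_value f a x1 < c1 by rewrite /c1 midf_lt.
have cb : c1 < tangent_value f b x1 by rewrite /c1 midf_lt.
(* The gaps between the two tangent values and [c1] leave room for moving both
   the evaluation point and the height. *)
exists (x1, c1).
have [e /andP[ae ec]] : exists e, tangent_value f a x1 < e < c1.
  by exists ((tangent_value f a x1 + c1) / 2); rewrite !midf_lt.
have [g /andP[cg gb]] : exists g, c1 < g < tangent_value f b x1.
  by exists ((c1 + tangent_value f b x1) / 2); rewrite !midf_lt.
have cT q : ball x0 r q ->
    tangent_value f q z.1 @[z --> (x1, c1)] --> tangent_value f q x1.
  move=> Bq; apply: continuous_cvg; last exact: cvg_fst.
  exact: (tangent_value_continuous (df _ Bq)).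
have c2 : z.2 @[z --> (x1, c1)] --> c1 by exact: cvg_snd.
near=> z.
apply: (@tangent_value_darboux _ _ _ a b) => //.
- exact: ball_open.
- by move=> p q t; exact: segment_in_ball.
- apply: (@lt_trans _ _ e).
    near: z; exact: (cvgr_lt _ (cT _ Ba) _ ae).
  near: z; exact: (cvgr_gt _ c2 _ ec).
- apply: (@lt_trans _ _ g).
    near: z; exact: (cvgr_lt _ c2 _ cg).
  near: z; exact: (cvgr_gt _ (cT _ Bb) _ gb).
Unshelve. all: by end_near. Qed.

End TangentValue.

(** * Locally flat connected sets *)

Lemma line_cvg_dnbhs (R : realType) (V : normedModType R) (p w : V) :
  (p + t *: w) @[t --> (0 : R)^'] --> p.
Proof.
have lim0 : (p + t *: w) @[t --> (0 : R)] --> p + (0 : R) *: w.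
  by apply: cvgD; [exact: cvg_cst|exact: scalel_continuous].
by rewrite scale0r addr0 in lim0; exact: cvg_within_filter.
Qed.

Section Flat.
Context {R : realType} {N : nat}.
Implicit Types (M U : set 'rV[R]_N) (W : {vspace 'rV[R]_N}) (p q : 'rV[R]_N).

(** The affine subspace is based at [p] itself, so that only its direction has to
be compared between different points of [M]. *)
Definition flat_near M U W p : Prop :=
  [/\ open U, U p & M `&` U = U `&` [set x | x - p \in W]].

Lemma flat_near_moved M U W p q :
  flat_near M U W p -> M q -> U q -> q - p \in W /\ flat_near M U W q.
Proof.
move=> [oU Up MU] Mq Uq.
have qpW : q - p \in W.
  have : (M `&` U) q by [].
  by rewrite MU => -[].
split=> //; split=> //; rewrite MU.
apply/seteqP; split=> z [Uz /= zW]; split=> //=.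
  by have -> : z - q = (z - p) - (q - p); [rewrite opprB addrA subrK|rewrite rpredB].
by have -> : z - p = (z - q) + (q - p); [rewrite addrA subrK|rewrite rpredD].
Qed.

(** The germ of [M] at [p] determines the direction: any vector of [W], once
shrunk, leads from [p] to a point of [M] inside [U']. *)
Lemma flat_near_direction_sub M U U' W W' p :
  M p -> flat_near M U W p -> flat_near M U' W' p -> (W <= W')%VS.
Proof.
move=> Mp [oU Up MU] [oU' Up' MU']; apply/subvP => w wW.
have cw : (p + t *: w) @[t --> (0 : R)^'] --> p.
  exact: line_cvg_dnbhs.
have [t [t0 Ut Ut']] : exists t : R, [/\ t != 0, U (p + t *: w) & U' (p + t *: w)].
  near (0 : R)^' => t; exists t; split.
  - by near: t; exact: nbhs_dnbhs_neq.
  - by near: t; apply: cw; exact: open_nbhs_nbhs.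
  - by near: t; apply: cw; exact: open_nbhs_nbhs.
have : (M `&` U) (p + t *: w).
  by rewrite MU; split=> //=; rewrite addrC addKr rpredZ.
move=> [Mt _]; have : (M `&` U') (p + t *: w) by [].
rewrite MU' => -[_] /=; rewrite addrC addKr => twW.
by rewrite -[w](scalerK t0) rpredZ.
Unshelve. all: by end_near. Qed.

(** The points of [M] near which [M] is flat along the subspace through [p0]
with direction [W0] form an open and closed subset of [M]: around a point of
the complement, [M] is flat along one subspace, which would contain [p0] and
have direction [W0] if a single point of that neighbourhood were good. *)
Lemma connected_flat_linear M :
  connected M -> (forall p, M p -> exists U W, flat_near M U W p) ->
  linear_submanifold M.
Proof.
move=> cM flatM.
have [[p0 Mp0]|M0] := pselect (M !=set0); last first.
  (* The empty set is an empty open piece of any subspace. *)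
  exists 0, 0%VS, set0; split; first exact: open0.
  by rewrite set0I; apply/seteqP; split=> // z Mz; case: M0; exists z.
have [U0 [W0 flat0]] := flatM _ Mp0.
pose good p := p - p0 \in W0 /\ exists U, flat_near M U W0 p.
pose O := \bigcup_(U in [set U | exists2 p,
  M p /\ p - p0 \in W0 & flat_near M U W0 p]) U.
pose O' := \bigcup_(U in [set U | exists p W,
  [/\ M p, ~ good p & flat_near M U W p]]) U.
have oO : open O by apply: bigcup_open => U [p _ []].
have oO' : open O' by apply: bigcup_open => U [p [W [_ _ []]]].
have MO : M `&` good = M.
  apply: cM.
  - exists p0; split=> //; split; first by rewrite subrr mem0v.
    by exists U0.
  - exists O => //; apply/seteqP; split=> q [Mq].
      move=> [qp0 [U fU]]; split=> //; exists U; last by case: fU.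
      by exists q.
    move=> [U [p [Mp pp0] fU] Uq]; split=> //.
    have [qp fq] := flat_near_moved fU Mq Uq.
    split; last by exists U.
    by have -> : q - p0 = (q - p) + (p - p0); [rewrite addrA subrK|rewrite rpredD].
  - exists (~` O'); first exact: open_closedC.
    apply/seteqP; split=> q [Mq].
      move=> [qp0 [U fU]]; split=> // -[U' [p [W [Mp ngp fU']] U'q]].
      have [qp fq] := flat_near_moved fU' Mq U'q.
      have WW0 : W = W0.
        apply/eqP; rewrite eqEsubv.
        by rewrite (flat_near_direction_sub Mq fq fU)
          (flat_near_direction_sub Mq fU fq).
      rewrite {}WW0 in fU' qp fq; apply: ngp; split; last by exists U'.
      have -> : p - p0 = (q - p0) - (q - p) by rewrite opprB [RHS]addrC subrKA.
      by rewrite rpredB.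
    move=> nO'q; split=> //; apply: contrapT => ngq; apply: nO'q.
    have [U [W fU]] := flatM _ Mq.
    by exists U; [exists q, W|case: fU].
exists p0, W0, O; split=> //; apply/seteqP; split=> z.
  move=> Mz; have [_ [zp0 [U fU]]] : (M `&` good) z by rewrite MO.
  by split=> //; exists U; [exists z|case: fU].
move=> [[U [p [Mp pp0] [oU Up MU]] Uz] /= zp0].
suff : (M `&` U) z by case.
rewrite MU; split=> //=.
by have -> : z - p = (z - p0) - (p - p0); [rewrite opprB addrA subrK|rewrite rpredB].
Qed.

End Flat.

(** * Graph charts *)

Section Charts.
Context {R : realType}.

Lemma continuous_sum_scale (T : topologicalType) (V : normedModType R)
  (I : Type) (s : seq I) (h : I -> T -> R) (v : I -> V) :
  (forall i, continuous (h i)) ->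
  continuous (fun x => \sum_(i <- s) h i x *: v i).
Proof.
move=> ch; elim: s => [|i s IHs] x.
  have -> : (fun x => \sum_(j <- [::]) h j x *: v j) = cst 0.
    by apply/funext => y; rewrite big_nil.
  exact: cvg_cst.
have -> : (fun x => \sum_(j <- i :: s) h j x *: v j) =
    (fun x => h i x *: v i + \sum_(j <- s) h j x *: v j).
  by apply/funext => y; rewrite big_cons.
by apply: cvgD; [apply: cvgZr_tmp; exact: ch|exact: IHs].
Qed.

Lemma continuous_subr (V : normedModType R) (c : V) :
  continuous (fun z : V => z - c).
Proof. by move=> z; apply: cvgB; [exact: cvg_id|exact: cvg_cst]. Qed.

(** Finite dimension is what makes a linear map continuous. *)
Lemma linear_rV_continuous n (V : normedModType R)
  (g : {linear 'rV[R]_n -> V}) : continuous g.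
Proof.
have -> : (g : _ -> V) = fun x => \sum_(i < n) x 0 i *: g (delta_mx 0 i).
  apply/funext => x; rewrite {1}[x]row_sum_delta linear_sum.
  by apply: eq_bigr => i _; rewrite linearZ.
apply: (@continuous_sum_scale _ _ _ _ (fun i (x : 'rV[R]_n) => x 0 i)) => i.
exact: coord_continuous.
Qed.

Lemma linear_rV_is_diff n (V : normedModType R) (g : {linear 'rV[R]_n -> V})
  (x : 'rV[R]_n) : is_diff x g g.
Proof.
have cg := @linear_rV_continuous _ _ g.
by apply: DiffDef; [exact: linear_differentiable|rewrite diff_lin].
Qed.

Context {d k N : nat}.
Implicit Types (c : 'rV[R]_N) (Q : 'M[R]_(d + k, N)) (f : 'rV[R]_d -> 'rV[R]_k).

Lemma graph_param_is_diff c Q f x : differentiable f x ->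
  is_diff x (graph_param c Q f) (fun v => row_mx v ('d f x v) *m Q).
Proof.
move=> df.
have rowE (v : 'rV[R]_d) (w : 'rV[R]_k) :
    row_mx v w *m Q = mulmxr (usubmx Q) v + mulmxr (dsubmx Q) w.
  by rewrite -[in LHS](vsubmxK Q) mul_row_col.
have -> : graph_param c Q f =
    cst c + (mulmxr (usubmx Q) + (mulmxr (dsubmx Q) \o f)).
  by apply/funext => y; rewrite /graph_param rowE.
have -> : (fun v => row_mx v ('d f x v) *m Q) =
    0 + ((mulmxr (usubmx Q) : _ -> _) + (mulmxr (dsubmx Q) \o 'd f x)).
  by apply/funext => v; rewrite rowE [RHS]add0r.
apply: is_diffD.
apply: is_diffD; first exact: linear_rV_is_diff.
apply: is_diff_comp; first exact: differentiableP.
exact: linear_rV_is_diff.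
Qed.

Lemma graph_param_tangent c Q f x v : differentiable f x ->
  graph_param c Q f x + 'd (graph_param c Q f) x v =
  c + row_mx (x + v) (f x + 'd f x v) *m Q.
Proof.
move=> /(@graph_param_is_diff c Q)[_ ->].
by rewrite /graph_param -addrA -mulmxDl add_row_mx.
Qed.

Lemma graph_paramK c Q f x : orthogonal_mx Q ->
  (graph_param c Q f x - c) *m Q^T = row_mx x (f x).
Proof. by case=> QQ _; rewrite /graph_param addrC addKr -mulmxA QQ mulmx1. Qed.

Lemma chart_coordK c Q z : orthogonal_mx Q -> c + (z - c) *m Q^T *m Q = z.
Proof. by case=> _ QQ; rewrite -mulmxA QQ mulmx1 addrC subrK. Qed.

Lemma chart_coord_continuous c Q : continuous (fun z : 'rV[R]_N => (z - c) *m Q^T).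
Proof.
move=> z; apply: (@continuous_comp _ _ _ (fun z : 'rV[R]_N => z - c) (mulmxr Q^T)).
  exact: continuous_subr.
exact: linear_rV_continuous.
Qed.

(** Shrinking [U] to the part of it above the ball makes the points of the
affine subspace inside it points of the graph over the ball. The direction is
the kernel of the linear map [g], which vanishes on the vectors whose vertical
coordinate is the image of the horizontal one under ['d f x0]. *)
Lemma flat_near_affine_graph (M U : set 'rV[R]_N) c Q V f x0 (r : R) :
  graph_chart M U c Q V f -> U (graph_param c Q f x0) -> 0 < r ->
  ball x0 r `<=` V ->
  (forall x, ball x0 r x -> f x = f x0 + 'd f x0 (x - x0)) ->
  exists U' W, flat_near M U' W (graph_param c Q f x0).
Proof.
move=> [oU oV oQ dfV MU] Up r0 BV fE; set p := graph_param c Q f x0.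
pose g y := rsubmx (y *m Q^T) - 'd f x0 (lsubmx (y *m Q^T)).
have g_lin : linear g.
  move=> a u v; rewrite /g mulmxDl -scalemxAl !linearP /=.
  by rewrite [in RHS]scalerDr addrACA.
pose gL : {linear 'rV[R]_N -> 'rV[R]_k} :=
  HB.pack g (GRing.isLinear.Build _ _ _ _ _ g_lin).
have WE y : (y \in lker (linfun gL)) = (g y == 0).
  by rewrite memv_ker lfunE.
pose U' := U `&` [set z | ball x0 r (lsubmx ((z - c) *m Q^T))].
exists U', (lker (linfun gL)); split.
- apply: openI => //.
  apply: (open_comp (f := fun z : 'rV[R]_N => lsubmx ((z - c) *m Q^T)));
    last exact: ball_open.
  move=> z _; apply: (@continuous_comp _ _ _
    (fun z : 'rV[R]_N => (z - c) *m Q^T) lsubmx).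
    exact: chart_coord_continuous.
  exact: continuous_lsubmx.
- split=> //=; rewrite graph_paramK // row_mxKl; exact: ballxx.
have gE z : g (z - p) =
    rsubmx ((z - c) *m Q^T) -
    (f x0 + 'd f x0 (lsubmx ((z - c) *m Q^T) - x0)).
  rewrite /g; have -> : z - p = (z - c) - (p - c) by rewrite opprB addrA subrK.
  rewrite mulmxBl graph_paramK // [rsubmx _]linearB [lsubmx _]linearB /=.
  by rewrite row_mxKl row_mxKr opprD addrA.
apply/seteqP; split=> z /=.
- move=> [Mz [Uz Bz]]; split=> //.
  rewrite WE gE.
  have [x Vx zE] : (graph_param c Q f @` V) z by rewrite -MU.
  move: Bz; rewrite -zE /= graph_paramK // row_mxKl row_mxKr => Bx.
  by rewrite -fE // subr_eq0.
move=> [[Uz Bz]]; rewrite WE gE subr_eq0 -fE // => /eqP zE; split=> //.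
have : (M `&` U) z; last by case.
rewrite MU; exists (lsubmx ((z - c) *m Q^T)); first exact: BV.
by rewrite /graph_param -zE hsubmxK chart_coordK.
Qed.

End Charts.

(** * Tangent hyperplanes of a nonlinear hypersurface *)

Lemma continuous_pair (T U V : topologicalType) (f : T -> U) (g : T -> V) :
  continuous f -> continuous g -> continuous (fun x => (f x, g x)).
Proof. by move=> cf cg x; apply: cvg_pair; [exact: cf|exact: cg]. Qed.

Section Hypersurface.
Context {R : realType} {n : nat}.

Lemma diff_entry (f : 'rV[R]_n -> 'rV[R]_1) x : differentiable f x ->
  is_diff x (fun y => f y 0 0) (fun v => 'd f x v 0 0).
Proof.
move=> df.
have e_lin : linear (fun y : 'rV[R]_1 => y 0 0 : R) by move=> a u v; rewrite !mxE.
pose e : {linear 'rV[R]_1 -> R} := HB.pack (fun y : 'rV[R]_1 => y 0 0 : R)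
  (GRing.isLinear.Build _ _ _ _ _ e_lin).
have de := linear_rV_is_diff e (f x).
exact: is_diff_comp (differentiableP df) de.
Qed.

(** The alternative for tangent values, read in the orthonormal coordinates of
the chart. *)
Lemma affine_or_tangents_interior (N : nat) (c : 'rV[R]_N) (Q : 'M[R]_(n + 1, N))
    (f : 'rV[R]_n -> 'rV[R]_1) x0 (r : R) :
  orthogonal_mx Q -> 0 < r -> (forall x, ball x0 r x -> differentiable f x) ->
  (forall x, ball x0 r x -> f x = f x0 + 'd f x0 (x - x0)) \/
  exists O : set 'rV[R]_N, [/\ open O, O !=set0 & forall z, O z ->
    exists x v, ball x0 r x /\
      z = graph_param c Q f x + 'd (graph_param c Q f) x v].
Proof.
move=> oQ r0 df; pose h x := f x 0 0.
have dh x : ball x0 r x -> is_diff x h (fun v => 'd f x v 0 0).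
  by move=> Bx; apply: diff_entry; exact: df.
have tE x y : ball x0 r x -> tangent_value h x y = (f x + 'd f x (y - x)) 0 0.
  by move=> /dh dhx; rewrite /tangent_value diff_val mxE.
have rE (u v : 'rV[R]_1) : u 0 0 = v 0 0 -> u = v.
  by move=> uv; apply/rowP => i; rewrite ord1.
have [| |[[x1 c1] cov]] := @affine_or_tangents_cover _ _ h x0 r r0.
- by move=> x /dh [].
- by move=> aff; left => x Bx; apply: rE; rewrite -tE -?aff //; exact: ballxx.
right.
pose coord (z : 'rV[R]_N) : 'rV[R]_n * R :=
  (lsubmx ((z - c) *m Q^T), rsubmx ((z - c) *m Q^T) 0 0).
have c_coord : continuous coord.
  apply: (@continuous_pair 'rV[R]_N 'rV[R]_n R (fun z => lsubmx ((z - c) *m Q^T))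
    (fun z => rsubmx ((z - c) *m Q^T) 0 0)) => z.
    apply: (@continuous_comp _ _ _
      (fun z : 'rV[R]_N => (z - c) *m Q^T) lsubmx).
      exact: chart_coord_continuous.
    exact: continuous_lsubmx.
  apply: (@continuous_comp _ _ _ (fun z : 'rV[R]_N => (z - c) *m Q^T)
    (fun y => rsubmx y 0 0)).
    exact: chart_coord_continuous.
  apply: (@continuous_comp _ _ _ rsubmx (fun y : 'rV[R]_1 => y 0 0)).
    exact: continuous_rsubmx.
  exact: coord_continuous.
pose S := [set z : 'rV[R]_n * R |
  exists2 p, ball x0 r p & tangent_value h p z.1 = z.2].
exists (coord @^-1` S°); split.
- by apply: open_comp => //; exact: open_interior.
- exists (c + row_mx x1 c1%:M *m Q); rewrite /= /coord.
  rewrite addrC addKr -mulmxA oQ.1 mulmx1 row_mxKl row_mxKr mxE eqxx.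
  exact: cov.
move=> z /= /interior_subset[x Bx]; rewrite tE // => xE.
exists x, (lsubmx ((z - c) *m Q^T) - x); split=> //.
rewrite graph_param_tangent; last exact: df.
have -> : f x + 'd f x (lsubmx ((z - c) *m Q^T) - x) = rsubmx ((z - c) *m Q^T).
  exact: rE.
by rewrite subrKC hsubmxK chart_coordK.
Qed.

(** A single chart suffices, which is what allows the charts of the factors of a
product to be combined. *)
Lemma nonlinear_hypersurface_tangents (M : set 'rV[R]_n.+1) :
  differentiable_hypersurface M -> ~ linear_submanifold M ->
  exists U c (Q : 'M[R]_(n + 1, n.+1)) V f O,
    [/\ graph_chart M U c Q V f, open O, O !=set0 & forall z, O z ->
      exists x v, V x /\ z = graph_param c Q f x + 'd (graph_param c Q f) x v].
Proof.
move=> [[cM _] chM] nl; apply: contrapT => none; apply: nl.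
apply: connected_flat_linear => // p Mp.
have [U [c [Q [V [f [Up ch]]]]]] := chM _ Mp.
have [oU oV oQ dfV MU] := ch.
have [x0 Vx0 pE] : (graph_param c Q f @` V) p by rewrite -MU.
have /nbhs_ballP[r /= r0 BV] : nbhs x0 V by exact: open_nbhs_nbhs.
rewrite -pE; apply: (flat_near_affine_graph ch _ r0 BV _); first by rewrite pE.
have dfB x : ball x0 r x -> differentiable f x by move/BV/dfV.
have [//|[G [oG G0 GE]]] := affine_or_tangents_interior c oQ r0 dfB.
exfalso; apply: none; exists U, c, Q, V, f, G; split=> // z /GE[x [v [Bx zE]]].
by exists x, v; split=> //; exact: BV.
Qed.

End Hypersurface.

(** * Orthogonal decompositions into blocks *)

Section Blocks.
Context {R : realType}.

(** The rows of the identity that belong to the block [i]: on row vectors,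
[x |-> x *m block_incl p i] is the inclusion of the block and its transpose is
the projection. *)
Definition block_incl {m} (p : 'I_m -> nat) (i : 'I_m) :
  'M[R]_(p i, \sum_(j < m) p j) := submxcol 1%:M i.

Lemma mulmx_block_incl m (p : 'I_m -> nat) i (x : 'rV[R]_(\sum_(j < m) p j)) :
  x *m (block_incl p i)^T = submxrow x i.
Proof. by rewrite /block_incl tr_submxcol trmx1 mul_submxrow mulmx1. Qed.

(** The row spaces of the [A i] form an orthogonal decomposition of the space of
dimension [D], with the rows of each [A i] as an orthonormal basis. *)
Definition orthogonal_family m D (a : 'I_m -> nat) (A : forall i, 'M[R]_(a i, D)) :=
  [/\ forall i, A i *m (A i)^T = 1%:M,
      forall i j, i != j -> A i *m (A j)^T = 0 &
      \sum_i (A i)^T *m A i = 1%:M].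

Lemma block_incl_orthogonal m (p : 'I_m -> nat) :
  orthogonal_family (block_incl p).
Proof.
have blockE i j : block_incl p i *m (block_incl p j)^T = submxblock 1%:M i j.
  by rewrite /block_incl tr_submxcol trmx1 submxcol_mul mul1mx -submxblockEh.
split=> [i|i j ij|].
- by rewrite blockE -(mxdiagZ 1) submxblock_diag.
- by rewrite blockE -(mxdiagZ 1) /mxdiag mxblockK (negPf ij).
rewrite -(mul_mxrow_mxcol (fun i => (block_incl p i)^T) (block_incl p)).
by rewrite -tr_mxcol submxcolK trmx1 mulmx1.
Qed.

(** Isometries between corresponding summands of two orthogonal decompositions
add up to an isometry. *)
Lemma orthogonal_sum m D D' (a : 'I_m -> nat) (A : forall i, 'M[R]_(a i, D))
  b (B : forall i, 'M[R]_(b i, D')) (Q : forall i, 'M[R]_(a i, b i)) :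
  orthogonal_family A -> orthogonal_family B ->
  (forall i, Q i *m (Q i)^T = 1%:M) ->
  (\sum_i (A i)^T *m Q i *m B i) *m (\sum_i (A i)^T *m Q i *m B i)^T = 1%:M.
Proof.
move=> [A1 A0 AS] [B1 B0 BS] QQ.
rewrite mulmx_suml -AS; apply: eq_bigr => i _.
rewrite linear_sum mulmx_sumr (bigD1 i) //= big1 ?addr0 => [|j ji].
  rewrite !trmx_mul trmxK -!mulmxA; congr (_ *m _).
  by rewrite (mulmxA (B i)) B1 mul1mx mulmxA QQ mul1mx.
rewrite !trmx_mul trmxK -!mulmxA (mulmxA (B i)) B0 ?mul0mx ?mulmx0 //.
by rewrite eq_sym.
Qed.

(** In a product of hypersurfaces the horizontal coordinates of all factors come
first, then the vertical coordinate of each factor. This is the inclusion of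
the coordinates of the factor [i], whose own vertical coordinate is last. *)
Definition graph_block {m} (p : 'I_m -> nat) (i : 'I_m) :
    'M[R]_(p i + 1, \sum_(j < m) p j + m) :=
  block_mx (block_incl p i) 0 0 (delta_mx 0 i).

Lemma mulmx_graph_block m (p : 'I_m -> nat) i
    (x : 'rV[R]_(\sum_(j < m) p j)) (w : 'rV[R]_m) :
  row_mx x w *m (graph_block p i)^T = row_mx (submxrow x i) (w *m delta_mx i 0).
Proof.
rewrite /graph_block tr_block_mx mul_row_block !trmx0 !mulmx0 addr0 add0r.
by rewrite mulmx_block_incl trmx_delta.
Qed.

Lemma graph_block_orthogonal m (p : 'I_m -> nat) :
  orthogonal_family (graph_block p).
Proof.
have [I1 I0 IS] := block_incl_orthogonal p.
have mulE i j : graph_block p i *m (graph_block p j)^T =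
    block_mx (block_incl p i *m (block_incl p j)^T) 0
      0 (delta_mx 0 i *m delta_mx j 0).
  rewrite /graph_block tr_block_mx mulmx_block !trmx0 !mulmx0 !mul0mx.
  by rewrite !addr0 !add0r trmx_delta.
split=> [i|i j ij|].
- rewrite mulE I1 mul_delta_mx.
  have -> : delta_mx 0 0 = 1%:M :> 'M[R]_1.
    by apply/matrixP => k l; rewrite !ord1 !mxE.
  by rewrite -scalar_mx_block.
- by rewrite mulE I0 // mul_delta_mx_0 // block_mx_const.
(* The sum over the blocks is computed separately on the horizontal and on the
   vertical coordinates, included by [e1] and [e2]. *)
pose e1 : 'M[R]_(\sum_(j < m) p j, \sum_(j < m) p j + m) := row_mx 1%:M 0.
pose e2 : 'M[R]_(m, \sum_(j < m) p j + m) := row_mx 0 1%:M.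
transitivity (\sum_i (e1^T *m ((block_incl p i)^T *m block_incl p i) *m e1 +
                      e2^T *m delta_mx i i *m e2)).
  apply: eq_bigr => i _.
  rewrite /graph_block tr_block_mx mulmx_block !trmx0 !mulmx0 !mul0mx.
  rewrite !addr0 !add0r.
  rewrite trmx_delta mul_delta_mx /e1 /e2 !tr_row_mx !trmx1 !trmx0.
  rewrite !mul_col_mx !mul0mx !mul1mx !mul_mx_row ?mulmx0 ?mulmx1 ?mul0mx.
  by rewrite add_col_mx !add0r !addr0.
rewrite big_split /= -!mulmx_suml -!mulmx_sumr IS mulmx1.
have -> : \sum_i delta_mx i i = 1%:M :> 'M[R]_m.
  by rewrite [RHS]mx1_sum_delta.
rewrite mulmx1 /e1 /e2 !tr_row_mx !trmx1 !trmx0 !mul_col_row.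
rewrite ?mul1mx ?mulmx1 ?mulmx0 ?mul0mx add_block_mx !addr0 !add0r.
by rewrite -scalar_mx_block.
Qed.

End Blocks.

(** * Charts of products *)

Lemma open_forall (T : topologicalType) (I : finType) (A : I -> set T) :
  (forall i, open (A i)) -> open [set x | forall i, A i x].
Proof.
move=> oA; rewrite openE => x Ax.
by apply: filter_forall => i; exact: open_nbhs_nbhs.
Qed.

Section ProductChart.
Context {R : realType} {m : nat} {n q : 'I_m -> nat}.
Context (M U : forall i, set 'rV[R]_(q i)) (c : forall i, 'rV[R]_(q i))
  (Q : forall i, 'M[R]_(n i + 1, q i)) (V : forall i, set 'rV[R]_(n i))
  (f : forall i, 'rV[R]_(n i) -> 'rV[R]_1).
Arguments M : clear implicits.
Arguments U : clear implicits.
Arguments V : clear implicits.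
Arguments f : clear implicits.

Definition product_graph_fun (x : 'rV[R]_(\sum_(i < m) n i)) : 'rV[R]_m :=
  \sum_i f i (submxrow x i) *m delta_mx 0 i.

Definition product_graph_mx : 'M[R]_(\sum_(i < m) n i + m, \sum_(i < m) q i) :=
  \sum_i (graph_block n i)^T *m Q i *m block_incl q i.

Local Notation pc := (\mxrow_i c i).

Lemma product_graph_mx_orthogonal :
  (forall i, orthogonal_mx (Q i)) -> orthogonal_mx product_graph_mx.
Proof.
move=> oQ; have oG := graph_block_orthogonal (R := R) n.
have oI := block_incl_orthogonal (R := R) q.
split; first by apply: (orthogonal_sum oG oI) => i; case: (oQ i).
have -> : product_graph_mx =
    (\sum_i (block_incl q i)^T *m (Q i)^T *m graph_block n i)^T.
  rewrite /product_graph_mx raddf_sum; apply: eq_bigr => i _ /=.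
  by rewrite !trmx_mul !trmxK mulmxA.
by rewrite trmxK; apply: (orthogonal_sum oI oG) => i; rewrite trmxK; case: (oQ i).
Qed.

Lemma submxrow_product_graph_mx
  (x : 'rV[R]_(\sum_(i < m) n i)) (w : 'rV[R]_m) i :
  submxrow (row_mx x w *m product_graph_mx) i =
  row_mx (submxrow x i) (w *m delta_mx i 0) *m Q i.
Proof.
have [I1 I0 _] := block_incl_orthogonal (R := R) q.
have QE : product_graph_mx *m (block_incl q i)^T = (graph_block n i)^T *m Q i.
  rewrite /product_graph_mx mulmx_suml [LHS](bigD1 i) //=.
  rewrite [X in _ + X]big1 => [|j ji]; last by rewrite -mulmxA I0 // mulmx0.
  by rewrite addr0 -mulmxA I1 mulmx1.
by rewrite -[LHS]mulmx_block_incl -mulmxA QE mulmxA mulmx_graph_block.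
Qed.

Lemma product_graph_fun_entry x i :
  product_graph_fun x *m delta_mx i 0 = f i (submxrow x i).
Proof.
rewrite /product_graph_fun mulmx_suml (bigD1 i) //= big1 ?addr0 => [|j ji].
  rewrite -mulmxA mul_delta_mx; have -> : delta_mx 0 0 = 1%:M :> 'M[R]_1.
    by apply/matrixP => k l; rewrite !ord1 !mxE.
  by rewrite mulmx1.
by rewrite -mulmxA mul_delta_mx_0 // mulmx0.
Qed.

Lemma submxrow_graph_param x i :
  submxrow (graph_param pc product_graph_mx product_graph_fun x) i =
  graph_param (c i) (Q i) (f i) (submxrow x i).
Proof.
by rewrite /graph_param submxrowD mxrowK submxrow_product_graph_mx
  product_graph_fun_entry.
Qed.

Lemma product_graph_fun_differentiable x :
  (forall i, differentiable (f i) (submxrow x i)) ->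
  differentiable product_graph_fun x.
Proof.
move=> df.
have -> : product_graph_fun = \sum_(i < m)
    (mulmxr (delta_mx 0 i : 'M[R]_(1, m)) \o
     (f i \o mulmxr (block_incl n i)^T)).
  apply/funext => y; rewrite fct_sumE; apply: eq_bigr => i _ /=.
  by rewrite mulmx_block_incl.
apply: differentiable_sum => i.
have [dI _] := linear_rV_is_diff (mulmxr (block_incl n i)^T) x.
have [dD _] := linear_rV_is_diff (mulmxr (delta_mx 0 i : 'M[R]_(1, m)))
  ((f i \o mulmxr (block_incl n i)^T) x).
apply: differentiable_comp dD; apply: differentiable_comp => //.
by rewrite /= mulmx_block_incl.
Qed.

(** Both sides differentiate the same function of [x], the vertical coordinate
of the factor [i]. *)
Lemma diff_product_graph_fun x v i :
  (forall i, differentiable (f i) (submxrow x i)) ->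
  'd product_graph_fun x v *m delta_mx i 0 =
  'd (f i) (submxrow x i) (submxrow v i).
Proof.
move=> df; have dg := product_graph_fun_differentiable df.
have [dD DE] := linear_rV_is_diff (mulmxr (delta_mx i 0 : 'M[R]_(m, 1)))
  (product_graph_fun x).
have [dI IE] := linear_rV_is_diff (mulmxr (block_incl n i)^T) x.
have dfi := df i; rewrite -mulmx_block_incl in dfi.
have := diff_comp dg dD; have := diff_comp dI dfi.
have -> : mulmxr (delta_mx i 0 : 'M[R]_(m, 1)) \o product_graph_fun =
    f i \o mulmxr (block_incl n i)^T.
  by apply/funext => y /=; rewrite product_graph_fun_entry mulmx_block_incl.
move=> -> /(congr1 (@^~ v)) /=; rewrite DE IE /= => <-.
by rewrite !mulmx_block_incl.
Qed.

Lemma open_blocks (p : 'I_m -> nat) (A : forall i, set 'rV[R]_(p i)) :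
  (forall i, open (A i)) ->
  open [set x : 'rV[R]_(\sum_(i < m) p i) | forall i, A i (submxrow x i)].
Proof.
move=> oA; apply: (@open_forall _ _ (fun i x => A i (submxrow x i))) => i.
have -> : (fun x => A i (submxrow x i)) = mulmxr (block_incl p i)^T @^-1` A i.
  by apply/funext => x /=; rewrite mulmx_block_incl.
by apply: open_comp => // x _; exact: linear_rV_continuous.
Qed.

Context
  (ch : forall i : 'I_m, graph_chart (M i) (U i) (c i) (Q i) (V i) (f i)).

Lemma product_graph_chart :
  graph_chart (product_set M) [set z | forall i, U i (submxrow z i)] pc
    product_graph_mx [set x | forall i, V i (submxrow x i)] product_graph_fun.
Proof.
split.
- by apply: open_blocks => i; case: (ch i).
- by apply: open_blocks => i; case: (ch i).
- by apply: product_graph_mx_orthogonal => i; case: (ch i).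
- move=> x Vx; apply: product_graph_fun_differentiable => i.
  by case: (ch i) => _ _ _ dfV _; exact: dfV.
apply/seteqP; split=> z.
  move=> [Mz Uz].
  have zE i : exists x,
      V i x /\ graph_param (c i) (Q i) (f i) x = submxrow z i.
    case: (ch i) => _ _ _ _ MU.
    have : (M i `&` U i) (submxrow z i) by split; [exact: Mz|exact: Uz].
    by rewrite MU => -[x Vx xz]; exists x.
  have [x xE] := fin_all_exists zE.
  exists (\mxrow_i x i).
    by move=> i /=; rewrite mxrowK; case: (xE i).
  apply/mxrowP => i; rewrite submxrow_graph_param mxrowK.
  by case: (xE i).
move=> [x Vx <-].
have MUi i : (M i `&` U i) (graph_param (c i) (Q i) (f i) (submxrow x i)).
  by case: (ch i) => _ _ _ _ ->; exists (submxrow x i) => //; exact: Vx.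
by split=> i; rewrite submxrow_graph_param; case: (MUi i).
Qed.

Lemma submxrow_product_tangent x v i :
  (forall i, V i (submxrow x i)) ->
  submxrow (graph_param pc product_graph_mx product_graph_fun x +
    'd (graph_param pc product_graph_mx product_graph_fun) x v) i =
  graph_param (c i) (Q i) (f i) (submxrow x i) +
    'd (graph_param (c i) (Q i) (f i)) (submxrow x i) (submxrow v i).
Proof.
move=> Vx; have df j : differentiable (f j) (submxrow x j).
  by case: (ch j) => _ _ _ dfV _; exact/dfV/Vx.
rewrite !graph_param_tangent //; last exact: product_graph_fun_differentiable.
rewrite submxrowD mxrowK submxrow_product_graph_mx submxrowD mulmxDl.
by rewrite product_graph_fun_entry diff_product_graph_fun.
Qed.

End ProductChart.

Unset Implicit Arguments.
Set Strict Implicit.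

Theorem theorem3p1p4 (R : realType) (m : nat) (n : 'I_m -> nat)
    (M : forall i : 'I_m, set 'rV[R]_(n i).+1)
    (hM : forall i : 'I_m, differentiable_hypersurface (M i))
    (hnl : forall i : 'I_m, ~ linear_submanifold (M i)) :
  interior (@codiagonal R (\sum_(i < m) (n i).+1)%N @`
    tangent_bundle (\sum_(i < m) n i)%N m
      (product_set (q := fun i => (n i).+1) M)) !=set0.
Proof.
have [U HU] := fin_all_exists (fun i =>
  nonlinear_hypersurface_tangents (hM i) (@hnl i)).
have [c Hc] := fin_all_exists HU; have [Q HQ] := fin_all_exists Hc.
have [V HV] := fin_all_exists HQ; have [f Hf] := fin_all_exists HV.
have [G HG] := fin_all_exists Hf.
have ch i : graph_chart (M i) (U i) (c i) (Q i) (V i) (f i) by case: (HG i).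
have [g gG] := fin_all_exists (fun i => let: And4 _ _ G0 _ := HG i in G0).
have oG : open [set z : 'rV[R]_(\sum_(i < m) (n i).+1) |
    forall i, G i (submxrow z i)].
  by apply: open_blocks => i; case: (HG i).
exists (\mxrow_i g i).
suff sub : [set z | forall i, G i (submxrow z i)] `<=`
    @codiagonal R (\sum_(i < m) (n i).+1)%N @`
      tangent_bundle (\sum_(i < m) n i)%N m
        (product_set (q := fun i => (n i).+1) M).
  by move: sub; rewrite open_subsetE //; apply => i; rewrite mxrowK; exact: gG.
move=> z Gz /=.
have [x Hx] := fin_all_exists (fun i =>
  let: And4 _ _ _ GE := HG i in GE _ (Gz i)).
have [v xv] := fin_all_exists Hx.
have chM := product_graph_chart ch; have [_ _ _ _ MU] := chM.
have Vx i : V i (submxrow (\mxrow_j x j) i) by rewrite mxrowK; case: (xv i).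
pose phi := graph_param (\mxrow_i c i) (product_graph_mx Q)
  (product_graph_fun f).
exists (phi (\mxrow_i x i), 'd phi (\mxrow_i x i) (\mxrow_i v i)).
  split=> /=.
    suff : (product_set M `&` [set z | forall i, U i (submxrow z i)])
      (phi (\mxrow_i x i)) by case.
    by rewrite MU; exists (\mxrow_i x i).
  by do 7 eexists; split; [exact: chM|exact: Vx|by []|by []].
apply/mxrowP => i; rewrite /codiagonal /= (submxrow_product_tangent ch) // !mxrowK.
by case: (xv i).
Qed.
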